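(* Let $T$ be an $r$-row rectangular (non-skew) fluctuating tableau of length $n$. Then (a) $\mathcal P^n(T)=T$, and (b) $L(\mathcal E(T))=\varepsilon(L(T))$.
   Context: An $r$-row generalized partition is $\lambda=(\lambda_1,\ldots,\lambda_r)\in\mathbb Z^r$ with $\lambda_1\ge\cdots\ge\lambda_r$. Let $\mathcal A_r$ be the set of subsets $S\subseteq\{\pm1,\ldots,\pm r\}$ all of whose elements have the same sign (including $\emptyset$); $\mathbf e_S=\sum_{s\in S}\mathbf e_s$ if $S$ is positive and $\mathbf e_S=-\sum_{s\in S}\mathbf e_{-s}$ if $S$ is negative ($\mathbf e_1,\dots,\mathbf e_r$ the standard basis of $\mathbb Z^r$). An $r$-row fluctuating tableau of length $n$ is a sequence $T=(\lambda^0,\ldots,\lambda^n)$ of $r$-row generalized partitions with $\lambda^k=\lambda^{k-1}+\mathbf e_{S_k}$, $S_k\in\mathcal A_r$; its lattice word is $L(T)=S_1S_2\cdots S_n$. It is non-skew if $\lambda^0=0$, and rectangular if moreover $\lambda^n_1=\cdots=\lambda^n_r$. For $\alpha\in\mathbb Z^r$, $\mathrm{sort}(\alpha)$ is its weakly decreasing rearrangement. The promotion–evacuation diagram of $T$ is $(\lambda^{i,j})_{0\le i\le n,\ i\le j\le n+i}$ with $\lambda^{0,j}=\lambda^j$, $\lambda^{i,i}=\lambda^0$, $\lambda^{i,n+i}=\lambda^n$ ($1\le i\le n$), and for $1\le i\le n$, $i<j<n+i$ (increasing $i$, then $j$), $\lambda^{i,j}=\mathrm{sort}(\lambda^{i-1,j}+\lambda^{i,j-1}-\lambda^{i-1,j-1})$.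 Promotion: $\mathcal P(T)=(\lambda^{1,1},\ldots,\lambda^{1,n+1})$; evacuation: $\mathcal E(T)=(\lambda^{n,n},\lambda^{n-1,n},\ldots,\lambda^{0,n})$. For a word $w_1\cdots w_n$ with letters in $\mathcal A_r$, $\varepsilon(w_1\cdots w_n)=\varepsilon(w_n)\cdots\varepsilon(w_1)$, where $\varepsilon(S)=\{\mathrm{sgn}(s)(r-|s|+1):s\in S\}$. *)

(* Defs.v *)
From mathcomp Require Import all_boot all_order all_algebra.

Set Implicit Arguments.
Unset Strict Implicit.
Unset Printing Implicit Defensive.

Import Order.TTheory GRing.Theory Num.Theory.
Local Open Scope ring_scope.

(* Rows are numbered from 0.  The pair (b, i) stands for the signed index     *)
(* i.+1 if b is false and - i.+1 if b is true.                                *)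
Notation signed_index r := (bool * 'I_r)%type.

Definition same_sign (r : nat) (S : {set signed_index r}) : bool :=
  [forall s in S, forall t in S, s.1 == t.1].

Definition alphabet (r : nat) : {set {set signed_index r}} :=
  [set S : {set signed_index r} | same_sign S].

(* On the alphabet all signs in S agree, so the sign factors out of the sum.  *)
Definition evec (r : nat) (S : {set signed_index r}) : 'rV[int]_r :=
  \sum_(s in S) (-1) ^+ s.1 *: delta_mx 0 s.2.

Definition generalized_partition (r : nat) (a : 'rV[int]_r) : Prop :=
  forall i j : 'I_r, (i <= j)%N -> a 0 j <= a 0 i.

Definition sortv (r : nat) (a : 'rV[int]_r) : 'rV[int]_r :=
  \row_i nth 0 (sort >=%R [seq a 0 k | k : 'I_r]) i.

Definition fluctuating_tableau (r n : nat) (T : n.+1.-tuple 'rV[int]_r) :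
    Prop :=
  (forall k, (k <= n)%N -> generalized_partition T`_k) /\
  (forall k, (k < n)%N ->
     exists2 S, S \in alphabet r & T`_k.+1 = T`_k + evec S).

Definition non_skew (r n : nat) (T : n.+1.-tuple 'rV[int]_r) : Prop :=
  T`_0 = 0.

Definition rectangular (r n : nat) (T : n.+1.-tuple 'rV[int]_r) : Prop :=
  non_skew T /\ forall i j : 'I_r, T`_n 0 i = T`_n 0 j.

(* The letter S with evec S = a; it is unique by evec_inj, and the default is *)
(* irrelevant for steps of a fluctuating tableau.                             *)
Definition letter (r : nat) (a : 'rV[int]_r) : {set signed_index r} :=
  odflt set0 [pick S in alphabet r | evec S == a].

Definition lattice_word (r n : nat) (T : n.+1.-tuple 'rV[int]_r) :
    n.-tuple {set signed_index r} :=
  [tuple letter (T`_k.+1 - T`_k) | k < n].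

(* Row i of the promotion-evacuation diagram, computed from row i - 1; the    *)
(* entries outside i <= j <= n + i are never used.                            *)
Fixpoint pe_row (r n : nat) (T : n.+1.-tuple 'rV[int]_r)
    (prev : nat -> 'rV[int]_r) (i j : nat) {struct j} : 'rV[int]_r :=
  if (j <= i)%N then T`_0
  else if (n + i <= j)%N then T`_n
  else if j is j'.+1
       then sortv (prev j + pe_row T prev i j' - prev j')
       else T`_0.

Fixpoint pe_diagram (r n : nat) (T : n.+1.-tuple 'rV[int]_r) (i : nat) :
    nat -> 'rV[int]_r :=
  if i is i'.+1 then pe_row T (pe_diagram T i') i else fun j => T`_j.

Definition promotion (r n : nat) (T : n.+1.-tuple 'rV[int]_r) :
    n.+1.-tuple 'rV[int]_r :=
  [tuple pe_diagram T 1 k.+1 | k < n.+1].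

Definition evacuation (r n : nat) (T : n.+1.-tuple 'rV[int]_r) :
    n.+1.-tuple 'rV[int]_r :=
  [tuple pe_diagram T (n - k) n | k < n.+1].

(* |s| = i.+1 is sent to r - |s| + 1 = (rev_ord i).+1.                        *)
Definition eps_letter (r : nat) (S : {set signed_index r}) :
    {set signed_index r} :=
  [set (s.1, rev_ord s.2) | s in S].

Definition eps_word (r n : nat) (w : n.-tuple {set signed_index r}) :
    n.-tuple {set signed_index r} :=
  [tuple of rev (map (@eps_letter r) w)].

Lemma evecE (r : nat) (S : {set signed_index r}) (i : 'I_r) :
  evec S 0 i = ((false, i) \in S)%:R - ((true, i) \in S)%:R.
Proof.
rewrite /evec summxE big_mkcond /=.
transitivity (\sum_(b : bool) \sum_(k | k == i)
    (if (b, k) \in S then (-1) ^+ b else 0 : int)).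
  rewrite (eq_bigr _ (fun b _ => big_mkcond _ _)) pair_bigA /=.
  apply: eq_bigr => -[b k] _ /=; rewrite !mxE eqxx /= eq_sym.
  by case: (k == i); case: (_ \in S); rewrite ?mulr1 ?mulr0.
rewrite big_bool /= !big_pred1_eq addrC.
by case: (_ \in S); case: (_ \in S).
Qed.

Lemma evec_inj (r : nat) : {in alphabet r &, injective (@evec r)}.
Proof.
have sgn (S : {set signed_index r}) i j : S \in alphabet r ->
    (false, i) \in S -> (true, j) \in S -> False.
  rewrite inE => /forall_inP SS Si Sj.
  by have /forall_inP /(_ _ Sj) := SS _ Si.
move=> S1 S2 A1 A2 eS; apply/setP => -[b i].
have := congr1 (fun a : 'rV[int]_r => a 0 i) eS; rewrite /= !evecE.
have := sgn _ i i A1; have := sgn _ i i A2.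
by case: b; do 4!case: (_ \in _) => //;
  move=> h1 h2 _; case: (h1 isT isT) || case: (h2 isT isT).
Qed.

Lemma pe_diagram_diag (r n : nat) (T : n.+1.-tuple 'rV[int]_r) (i : nat) :
  pe_diagram T i i = T`_0.
Proof. by case: i => //= i; rewrite leqnn. Qed.

Lemma pe_diagram_last (r n : nat) (T : n.+1.-tuple 'rV[int]_r) (i : nat) :
  pe_diagram T i (n + i) = T`_n.
Proof.
case: i => [|i]; first by rewrite addn0.
case: n T => [|n] T; first exact: pe_diagram_diag.
by rewrite addSn /= ltnS addnS ltnNge leq_addl /= addSn addnS leqnn.
Qed.

Lemma pe_diagram_local_rule (r n : nat) (T : n.+1.-tuple 'rV[int]_r)
    (i j : nat) : (0 < i)%N -> (i < j < n + i)%N ->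
  pe_diagram T i j =
  sortv (pe_diagram T i.-1 j + pe_diagram T i j.-1 - pe_diagram T i.-1 j.-1).
Proof.
case: i j => // i [|j] // _ /andP[ij jn].
by rewrite /= leqNgt ij leqNgt jn.
Qed.

(* Main.v *)
Require Import Defs.
From mathcomp Require Import all_boot all_order all_algebra all_fingroup.
From mathcomp Require Import zify ring lra.

Set Implicit Arguments.
Unset Strict Implicit.
Unset Printing Implicit Defensive.

Import Order.TTheory GRing.Theory Num.Theory.
Local Open Scope ring_scope.

(* Fix k and assign to a sequence of vectors the maximum, over sequences      *)
(* (K_t), of the sum over t of the entries of step t in the rows K_t, where   *)
(* the K_t are k-subsets of the rows whose elements move weakly up as t       *)
(* increases.  For a fluctuating tableau starting at 0 this is D_k, the sum   *)
(* of the first k entries of its final partition, and the local rule shows    *)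
(* that the maximum does not decrease from the segment [i, n] of one row of   *)
(* the diagram to the same segment of the next row.  Using constant K_t in    *)
(* row 0, one gets that lambda^(i,n) dominates the complement of lambda^(0,i) *)
(* in the final rectangle.  Applied twice, this gives D_k(P^n(T)_i) >=        *)
(* D_k(T_i). These integers are bounded and promotion is injective, so        *)
(* equality holds throughout: P^n(T) = T, and lambda^(i,n) equals the         *)
(* complement of lambda^(0,i), which is the statement on evacuation.          *)

(** Write [D_k] for the sum of the first k entries. Each square of the diagram has two properties,
    both in [local_rule]: it can be inverted, and a subset of rows can be carried across it, moving
    only upwards. The second gives the monotonicity of chains in [chain_iter_promotion];
    [chain_value_dominant] bounds a chain starting at 0 by [D_k]. Together they give
    [iter_promotion_complement_le], and two uses of it sandwich [D_k] of the complement of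
    lambda^(i,n) between the values for T and for P^n(T) ([iter_promotion_n_ge]). Iterating P^n
    gives bounded increasing integers, which must stall; [promotion_inj] carries the equality found
    there back to T ([promotion_order]). The sandwich then collapses ([iter_promotion_complement]):
    evacuation replaces lambda^(n-k) by its complement in the final rectangle. This reverses the
    order of the steps and of the rows and keeps the signs, which is epsilon. *)

Section Vectors.
Variable r : nat.
Implicit Types (x y z l v : 'rV[int]_r) (f g h : nat -> int) (k : nat).

(** * Letters and sorting *)

Lemma row_addE x y i : (x + y) 0 i = x 0 i + y 0 i.
Proof. by rewrite !mxE. Qed.

Lemma row_subE x y i : (x - y) 0 i = x 0 i - y 0 i.
Proof. by rewrite !mxE. Qed.

Lemma row_permE (s : 'S_r) x i : (col_perm s x) 0 i = x 0 (s i).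
Proof. by rewrite !mxE. Qed.

Definition is_letter v := exists2 S, S \in alphabet r & v = evec S.

(** What the local rule uses of a letter: a condition common to both signs and stable under
    permuting rows. *)
Definition minuscule v := forall a b : 'I_r, v 0 a - v 0 b <= 1.

Lemma is_letterP v :
  is_letter v <->
  exists e : bool, forall a, exists d : bool, v 0 a = (-1) ^+ e * d%:R.
Proof.
split=> [[S]|[e He]].
  rewrite inE => /forall_inP SS ->.
  have [/exists_inP[p pS pt]|/exists_inPn none] := boolP [exists p in S, p.1].
    exists true => a; exists ((true, a) \in S); rewrite evecE.
    have -> : ((false, a) \in S) = false.
      apply/negP => /SS /forall_inP /(_ p pS); by rewrite /= pt.
    by rewrite /=; case: (_ \in _); lia.
  exists false => a; exists ((false, a) \in S); rewrite evecE.
  have -> : ((true, a) \in S) = false.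
    by apply/negP => /none.
  by rewrite /=; case: (_ \in _); lia.
exists [set p | (p.1 == e) && (v 0 p.2 != 0)].
  rewrite inE; apply/forall_inP => p; rewrite inE => /andP[/eqP-> _].
  by apply/forall_inP => q; rewrite inE => /andP[/eqP-> _].
apply/rowP => a; rewrite evecE !inE /=.
have [d ->] := He a.
by case: e He; case: d.
Qed.

Lemma is_letter_minuscule v : is_letter v -> minuscule v.
Proof.
move=> /is_letterP[e He] a b.
by have [d ->] := He a; have [d' ->] := He b; case: e He; case: d; case: d'.
Qed.

Lemma is_letter_le1 v a : is_letter v -> v 0 a <= 1.
Proof.
by move=> /is_letterP[e He]; have [d ->] := He a; case: e He; case: d.
Qed.

Lemma is_letter_perm (s : 'S_r) v : is_letter v -> is_letter (col_perm s v).
Proof.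
move=> /is_letterP[e He]; apply/is_letterP; exists e => a.
by have [d Hd] := He (s a); exists d; rewrite mxE.
Qed.

Lemma generalized_partition_adj x :
  (forall a b : 'I_r, b = a.+1 :> nat -> x 0 b <= x 0 a) ->
  generalized_partition x.
Proof.
move=> adj i j ij; have [d Hd] : exists d, j = (i + d)%N :> nat.
  by exists (j - i)%N; lia.
elim: d j {ij} Hd => [|d IH] j Hd.
  by have -> : j = i by apply: val_inj; rewrite /= Hd addn0.
have dr : (i + d < r)%N by have := ltn_ord j; lia.
by apply: le_trans (IH (Ordinal dr) _); rewrite //; apply: adj; rewrite /=; lia.
Qed.

Lemma sortv_perm (s : 'S_r) z :
  generalized_partition (col_perm s z) -> sortv z = col_perm s z.
Proof.
move=> part; have trn : transitive (>=%R : rel int).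
  by move=> a b c /= ba cb; apply: le_trans cb ba.
have tot : total (>=%R : rel int) by move=> a b; apply: ge_total.
have asym : antisymmetric (>=%R : rel int).
  by move=> a b /= /andP[]; lia.
have eq_sort : sort >=%R [seq z 0 k | k : 'I_r] =
               [seq col_perm s z 0 k | k : 'I_r].
  rewrite -[RHS](@sorted_sort _ (>=%R : rel int)) //.
    apply/perm_sortP => //; rewrite /image_mem.
    have /eq_map -> : (fun i => col_perm s z 0 i) =1 z 0 \o s.
      by move=> i; rewrite mxE.
    rewrite (map_comp (z 0) s) perm_sym; apply: perm_map.
    apply: uniq_perm; rewrite ?enum_uniq //.
      by rewrite map_inj_uniq ?enum_uniq //; apply: perm_inj.
    move=> i; rewrite mem_enum; apply/mapP; exists (s^-1 i)%g => //.
      by rewrite mem_enum.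
    by rewrite permKV.
  rewrite /image_mem; apply/(sortedP 0) => i; rewrite size_map size_enum_ord => ir.
  have ir' := ltnW ir; rewrite !(nth_map (Ordinal ir)) -?enumT ?size_enum_ord //.
  by apply: part; rewrite !nth_enum_ord.
apply/rowP => i; rewrite mxE eq_sort (nth_map i) ?size_enum_ord //.
by rewrite nth_ord_enum.
Qed.

(** * Sums over subsets of rows *)

Definition dot x f : int := \sum_(c < r) x 0 c * (f c.+1 - f c).

(* [f c] is the number of elements [< c] of a [k]-subset of the rows, and     *)
(* [dot x f] is the sum of [x] over it; moving the subset up increases [f].   *)
Definition profile k f : Prop :=
  [/\ f 0%N = 0, f r = k%:Z & forall c, (c < r)%N -> 0 <= f c.+1 - f c <= 1].

Lemma dotD x y f : dot (x + y) f = dot x f + dot y f.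
Proof. by rewrite -big_split; apply: eq_bigr => c _; rewrite mxE mulrDl. Qed.

Lemma dotB x y f : dot (x - y) f = dot x f - dot y f.
Proof. by rewrite -sumrB; apply: eq_bigr => c _; rewrite !mxE mulrBl. Qed.

Lemma dot0 f : dot 0 f = 0.
Proof. by rewrite /dot big1 // => c _; rewrite mxE mul0r. Qed.

Lemma dot_const C x f : (forall i, x 0 i = C) -> dot x f = C * (f r - f 0%N).
Proof.
move=> xC; rewrite -(telescope_sumr f (leq0n r)) big_mkord mulr_sumr.
by apply: eq_bigr => c _; rewrite xC.
Qed.

Lemma dot_modular x f g f' g' :
  (forall c, (c <= r)%N -> f c + g c = f' c + g' c) ->
  dot x f + dot x g = dot x f' + dot x g'.
Proof.
move=> fg; rewrite -!big_split; apply: eq_bigr => c _ /=; rewrite -!mulrDr.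
have := fg c.+1 (ltn_ord c); have := fg c (ltnW (ltn_ord c)) => e1 e2.
congr (_ * _); lia.
Qed.

(** Summation by parts: the boundary terms cancel, and what remains pairs the descents of [x] with
    [g - f]. *)
Lemma dot_mono x f g : generalized_partition x -> f 0%N = g 0%N -> f r = g r ->
  (forall c, (c <= r)%N -> f c <= g c) -> dot x f <= dot x g.
Proof.
move=> part f0 fr fg.
pose e c := if insub c is Some i then x 0 i else 0.
have ex (c : 'I_r) : e c = x 0 c by rewrite /e valK.
have dotE h : dot x h = \sum_(0 <= c < r) e c * (h c.+1 - h c).
  by rewrite big_mkord; apply: eq_bigr => c _; rewrite ex.
have edec c : (c.+1 < r)%N -> e c.+1 <= e c.
  move=> cr; rewrite -[c.+1]/(val (Ordinal cr)) -[c]/(val (Ordinal (ltnW cr))).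
  by rewrite !ex; apply: part => /=.
(* The left side is the boundary term of the partial summation; it vanishes at [m = r]. *)
have partial m : (m <= r)%N ->
    e m.-1 * (g m - f m) <=
    \sum_(0 <= c < m) e c * ((g c.+1 - f c.+1) - (g c - f c)).
  elim: m => [|m IH] mr; first by rewrite big_geq // f0 subrr mulr0.
  rewrite big_nat_recr //=.
  have := IH (ltnW mr); case: m mr {IH} => [|m] mr /=.
    by move=> _; rewrite big_geq // f0 subrr subr0 add0r.
  have := edec m mr; have := fg m.+1 (ltnW mr); set S := \sum_(_ <= _ < _) _.
  by move=> h1 h2; have : 0 <= (e m - e m.+1) * (g m.+1 - f m.+1);
    [apply: mulr_ge0; lia | lra].
have := partial r (leqnn r); rewrite fr subrr mulr0 -subr_ge0 => le0.
rewrite -subr_ge0 !dotE -sumrB; apply: le_trans le0 _; rewrite subr0.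
by rewrite le_eqVlt; apply/orP; left; apply/eqP/eq_bigr => c _; lia.
Qed.

(** * Exchanges of rows and the local rule *)

Lemma dot_split2 x f (a b : 'I_r) : a != b ->
  dot x f = x 0 a * (f a.+1 - f a) + x 0 b * (f b.+1 - f b) +
    \sum_(c | (c != a) && (c != b)) x 0 c * (f c.+1 - f c).
Proof.
move=> ab; rewrite /dot (bigD1 a) //= (bigD1 b) /= 1?eq_sym //.
by rewrite addrA.
Qed.

Lemma dot_tperm x f (a b : 'I_r) : a != b ->
  dot (col_perm (tperm a b) x) f =
  dot x f + (x 0 b - x 0 a) * ((f a.+1 - f a) - (f b.+1 - f b)).
Proof.
move=> ab; rewrite !(dot_split2 _ _ ab) !mxE tpermL tpermR.
rewrite (eq_bigr (fun c : 'I_r => x 0 c * (f c.+1 - f c))); first by ring.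
by move=> c /andP[ca cb]; rewrite mxE tpermD // eq_sym.
Qed.

(** If row [b] is counted and the row just above it is not, this replaces [b] by that row. *)
Definition bump f (b : nat) (c : nat) : int := f c + (c == b)%:R.

Lemma dot_bump x f (a b : 'I_r) : b = a.+1 :> nat ->
  dot x (bump f b) = dot x f + x 0 a - x 0 b.
Proof.
move=> ab; have nab : a != b by apply/eqP => e; move: ab; rewrite e; lia.
rewrite !(dot_split2 _ _ nab) /bump.
rewrite (eq_bigr (fun c : 'I_r => x 0 c * (f c.+1 - f c))); last first.
  move=> c /andP[]; rewrite -!val_eqE /= => ca cb; congr (_ * _).
  have -> : (c.+1 == b) = false by lia.
  have -> : (c == b :> nat) = false by lia.
  by rewrite !addr0.
have -> : (a.+1 == b) = true by lia.
have -> : (a == b :> nat) = false by lia.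
have -> : (b.+1 == b :> nat) = false by lia.
by rewrite eqxx /= ?mulr1n ?mulr0n; ring.
Qed.

(** On subsets this takes, for each i, the smaller of the two i-th elements. *)
Lemma profile_max k f g :
  profile k f -> profile k g -> profile k (fun c => Num.max (f c) (g c)).
Proof.
move=> [f0 fr fi] [g0 gr gi]; split; rewrite ?f0 ?fr ?g0 ?gr ?maxxx //.
by move=> c cr; have := fi c cr; have := gi c cr; lia.
Qed.

(* Bubble sort: an ascent of [z] at adjacent rows forces [y] and [l] to be    *)
(* equal there, so sorting [z] only permutes rows that [y] and [l] do not     *)
(* distinguish.  When an exchange would lower [dot z f], a counted row is     *)
(* moved up instead; this is free for [y] and [l].                            *)
Lemma sort_local y l z :
  generalized_partition y -> generalized_partition l ->
  minuscule (z - y) -> minuscule (l - z) ->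
  exists s : 'S_r, [/\ generalized_partition (col_perm s z),
    col_perm s y = y, col_perm s l = l &
    forall k f, profile k f -> exists g, [/\ profile k g,
      forall c, (c <= r)%N -> f c <= g c,
      dot y g = dot y f, dot l g = dot l f & dot z f <= dot (col_perm s z) g]].
Proof.
move=> party partl.
(* The induction is on a bound for the sum of [c * (z_c + N)]: it is nonnegative, and exchanging an
   ascent lowers it by at least 1. The weight [w] is chosen with increments [c]. *)
pose N : int := \sum_c `|z 0 c|.
have : forall c, - N <= z 0 c.
  move=> c; have : `|z 0 c| <= N.
    by rewrite /N (bigD1 c) //= lerDl; apply: sumr_ge0.
  lia.
move: N => N zN.
have [w wS] : exists w : nat -> int, forall c, w c.+1 - w c = c%:R.
  by exists (fun c => 'C(c, 2)%:R) => c; rewrite binS bin1; lia.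
have [m] : exists m : nat, dot z w + dot (const_mx N) w <= m%:Z.
  by exists (absz (dot z w + dot (const_mx N) w)); lia.
elim: m z zN => [|m IH] z zN zm zy lz.
all: have [/forallP sorted|] := boolP
  [forall a : 'I_r, forall b : 'I_r, (b == a.+1 :> nat) ==> (z 0 b <= z 0 a)].
1,3: exists 1%g; rewrite !col_perm1; split=> //.
1,3: by apply: generalized_partition_adj => a b ab;
   have /forallP/(_ b)/implyP := sorted a; apply; apply/eqP.
1,2: by move=> k f pf; exists f; split.
all: move=> /forallPn[a /forallPn[b]]; rewrite negb_imply => /andP[/eqP ab nzab].
all: have zab : z 0 a < z 0 b by rewrite ltNge.
all: have nab : a != b by apply/eqP => e; move: ab; rewrite e; lia.
all: have [z1 z1E] : exists z1, z1 = col_perm (tperm a b) z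
  by exists (col_perm (tperm a b) z).
all: have leab : (a <= b)%N by rewrite ab.
all: have z1N : forall c, - N <= z1 0 c by move=> c; rewrite z1E mxE.
all: have z1w : dot z1 w <= dot z w - 1 by rewrite z1E dot_tperm // !wS ab; lia.
  (* For measure 0, an ascent is impossible: exchanging it would make the measure negative. *)
  have : 0 <= dot z1 w + dot (const_mx N) w; last by lia.
  rewrite -dotD; apply: sumr_ge0 => c _; rewrite wS mxE [const_mx _ _ _]mxE.
  by rewrite mulr_ge0 ?ler0n // -lerBlDr sub0r.
have ya : y 0 a = y 0 b.
  by have := zy b a; have := party a b leab; rewrite !row_subE; lia.
have la : l 0 a = l 0 b.
  by have := lz a b; have := partl a b leab; rewrite !row_subE; lia.
have fix_tperm x : x 0 a = x 0 b -> col_perm (tperm a b) x = x.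
  by move=> xab; apply/rowP => c; rewrite mxE; case: tpermP => // ->.
have zab1 : z 0 b = z 0 a + 1.
  by have := zy b a; rewrite !row_subE; lia.
have z1y : minuscule (z1 - y).
  rewrite z1E -(fix_tperm y ya) => c d.
  by have := zy (tperm a b c) (tperm a b d); rewrite !row_subE !row_permE.
have lz1 : minuscule (l - z1).
  rewrite z1E -(fix_tperm l la) => c d.
  by have := lz (tperm a b c) (tperm a b d); rewrite !row_subE !row_permE.
have [|s [sz sy sl sf]] := IH z1 z1N _ z1y lz1; first by lia.
exists (s * tperm a b)%g; rewrite !col_permM (fix_tperm y ya) (fix_tperm l la) -z1E.
split=> // k f pf.
have [le_ab|lt_ab] := lerP (f b.+1 - f b) (f a.+1 - f a).
  have [g [pg fg yg lg zg]] := sf k f pf; exists g; split=> //.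
  by apply: le_trans zg; rewrite z1E dot_tperm // lerDl; apply: mulr_ge0; lia.
have [f0 fr fi] := pf.
have fa := fi a (ltn_ord a); have fb := fi b (ltn_ord b).
have pf1 : profile k (bump f b).
  split; rewrite /bump.
  - by rewrite f0 ab.
  - have -> : (r == b) = false by have := ltn_ord b; lia.
    by rewrite addr0.
  - move=> c cr; have := fi c cr; rewrite /= ab eqSS.
    have [ca|] := eqVneq c (nat_of_ord a).
      have -> : (c == a.+1) = false by lia.
      by move: lt_ab fa fb; rewrite ab ca /=; lia.
    have [ca|] := eqVneq c a.+1; last by lia.
    by move: lt_ab fa fb; rewrite ab ca /=; lia.
have [g [pg fg yg lg zg]] := sf k (bump f b) pf1; exists g; split=> //.
- move=> c cr; apply: le_trans (fg c cr); rewrite /bump; lia.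
- by rewrite yg (dot_bump _ _ ab) ya; lia.
- by rewrite lg (dot_bump _ _ ab) la; lia.
- apply: le_trans zg; rewrite z1E (dot_bump _ _ ab) dot_tperm //.
  rewrite !row_permE tpermL tpermR.
  have -> : f a.+1 - f a = 0 by lia.
  have -> : f b.+1 - f b = 1 by lia.
  lia.
Qed.

(** The sorting permutation fixes [y] and [l], so the new steps are the old ones with rows permuted,
    and [y + l - z] is a rearrangement of [x]: the rule is an involution. *)
Lemma local_rule x y l : generalized_partition x -> generalized_partition y ->
  generalized_partition l -> minuscule (l - x) -> minuscule (x - y) ->
  let z := sortv (l + y - x) in
  [/\ generalized_partition z,
      exists s : 'S_r, z - y = col_perm s (l - x) /\ l - z = col_perm s (x - y),
      x = sortv (y + l - z) &
      forall k f, profile k f -> exists g, [/\ profile k g,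
        forall c, (c <= r)%N -> f c <= g c,
        dot y g = dot y f, dot l g = dot l f &
        dot (l + y - x) f <= dot z g]].
Proof.
move=> partx party partl lx xy z.
have ey : l + y - x - y = l - x by rewrite addrAC addrK.
have el : l - (l + y - x) = x - y by rewrite -addrA opprD addNKr opprD opprK addrC.
have [||s [sz sy sl sf]] := @sort_local y l (l + y - x) party partl.
- by rewrite ey.
- by rewrite el.
have zE : z = col_perm s (l + y - x) by apply: sortv_perm.
split=> //; rewrite zE //.
  exists s; split; first by rewrite -{2}sy -linearB /= ey.
  by rewrite -{1}sl -linearB /= el.
have <- : col_perm s x = y + l - col_perm s (l + y - x).
  by rewrite -{1}sy -{1}sl -linearD -linearB /= [y + l]addrC subKr.
have xE : x = col_perm s^-1 (col_perm s x) by rewrite -col_permM mulVg col_perm1.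
by rewrite (@sortv_perm s^-1) -xE.
Qed.

End Vectors.

Section Tableaux.
Variables r n : nat.
Implicit Types (T U : n.+1.-tuple 'rV[int]_r) (x y : 'rV[int]_r).
Implicit Types (p : nat -> 'rV[int]_r) (f g : nat -> int) (i j k t : nat).

(** * Promotion of rectangular tableaux *)

Definition rectangular_tableau T := fluctuating_tableau T /\ rectangular T.

Lemma fluctuating_step T k : fluctuating_tableau T -> (k < n)%N ->
  is_letter (T`_k.+1 - T`_k).
Proof. by move=> [_ fl] /fl[S AS ->]; exists S; rewrite // addrC addKr. Qed.

Lemma fluctuatingI T : (forall k, (k <= n)%N -> generalized_partition T`_k) ->
  (forall k, (k < n)%N -> is_letter (T`_k.+1 - T`_k)) -> fluctuating_tableau T.
Proof.
move=> part steps; split=> // k /steps[S AS eS].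
by exists S; rewrite // -eS addrC subrK.
Qed.

Lemma promotion_nth T k : (k <= n)%N -> (promotion T)`_k = pe_diagram T 1 k.+1.
Proof.
by rewrite -ltnS => kn; rewrite -(tnth_nth 0 _ (Ordinal kn)) tnth_mktuple.
Qed.

Lemma promotion0 T : (promotion T)`_0 = T`_0.
Proof. by rewrite promotion_nth // pe_diagram_diag. Qed.

Lemma promotion_last T : (promotion T)`_n = T`_n.
Proof.
by rewrite promotion_nth // -[X in pe_diagram _ _ X]addn1 pe_diagram_last.
Qed.

Lemma promotionS T k : (k.+1 < n)%N ->
  (promotion T)`_k.+1 = sortv (T`_k.+2 + (promotion T)`_k - T`_k.+1).
Proof.
move=> kn; rewrite !promotion_nth ?(ltnW kn) ?(ltnW (ltnW kn)) //.
by rewrite pe_diagram_local_rule // addn1 /= ltnS.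
Qed.

(** The first vertical step of the diagram is the first step of [T], and each square passes it on
    with rows permuted. Both claims are needed to enter the next square. *)
Lemma promotion_step T k : rectangular_tableau T -> (k < n)%N ->
  generalized_partition (promotion T)`_k /\
  is_letter (T`_k.+1 - (promotion T)`_k).
Proof.
move=> [flT [T0 _]]; have [partT _] := flT; elim: k => [|k IH] kn.
  rewrite promotion0; split; first exact: partT.
  exact: fluctuating_step.
have [part_k let_k] := IH (ltnW kn); rewrite promotionS //.
have [|||||part [s [_ ->]] _ _] :=
  @local_rule r T`_k.+1 (promotion T)`_k T`_k.+2.
- by apply: partT; apply: ltnW.
- exact: part_k.
- exact: partT.
- exact/is_letter_minuscule/fluctuating_step.
- exact: is_letter_minuscule.
by split=> //; apply: is_letter_perm.
Qed.

Lemma promotion_local T k : rectangular_tableau T -> (k.+1 < n)%N ->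
  let x := T`_k.+1 in let l := T`_k.+2 in
  let y := (promotion T)`_k in let z := (promotion T)`_k.+1 in
  [/\ generalized_partition x,
      exists s : 'S_r, z - y = col_perm s (l - x),
      x = sortv (y + l - z) &
      forall m f, profile r m f -> exists g, [/\ profile r m g,
        forall c, (c <= r)%N -> f c <= g c,
        dot y g = dot y f, dot l g = dot l f &
        dot (l + y - x) f <= dot z g]].
Proof.
move=> rT kn /=; have [flT [T0 _]] := rT; have [partT _] := flT.
have [part_k let_k] := promotion_step rT (ltnW kn).
rewrite promotionS //.
have [|||||part [s [st _]] inv chain] :=
  @local_rule r T`_k.+1 (promotion T)`_k T`_k.+2.
- by apply: partT; apply: ltnW.
- exact: part_k.
- exact: partT.
- exact/is_letter_minuscule/fluctuating_step.
- exact: is_letter_minuscule.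
by split=> //; [apply: partT; apply: ltnW | exists s].
Qed.

Lemma promotion_rectangular T : rectangular_tableau T ->
  rectangular_tableau (promotion T).
Proof.
move=> rT; have [flT [T0 Tn]] := rT; have [partT _] := flT.
split; last by rewrite /rectangular /non_skew promotion0 promotion_last.
apply: fluctuatingI => k.
  rewrite leq_eqVlt => /predU1P[->|kn]; last by have [] := promotion_step rT kn.
  by rewrite promotion_last; apply: partT.
move=> kn; have [kn1|] := ltnP k.+1 n.
  have [_ [s ->] _ _] := promotion_local rT kn1.
  exact/is_letter_perm/fluctuating_step.
move=> nk; have nE : n = k.+1 by lia.
(* Both rows end at the same partition, so the last horizontal step is the last vertical one. *)
have [_] := promotion_step rT kn; rewrite -nE.
by rewrite promotion_last.
Qed.

(** [T] is recovered from its right end, which promotion keeps, by running the local rule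
    backwards. *)
Lemma promotion_inj T U : rectangular_tableau T -> rectangular_tableau U ->
  promotion T = promotion U -> T = U.
Proof.
move=> rT rU PTU; have T0 : T`_0 = 0 by case: rT => _ [].
have U0 : U`_0 = 0 by case: rU => _ [].
have TUn d : (d <= n)%N -> T`_(n - d) = U`_(n - d).
  elim: d => [|d IH] dn; first by rewrite subn0 -promotion_last PTU promotion_last.
  have := IH (ltnW dn); have -> : (n - d = (n - d.+1).+1)%N by lia.
  case kE: (n - d.+1)%N => [|k]; first by rewrite T0 U0.
  have kn : (k.+1 < n)%N by lia.
  have [_ _ eT _] := promotion_local rT kn.
  have [_ _ eU _] := promotion_local rU kn.
  by move=> IHk; rewrite PTU IHk in eT; apply: etrans eT (esym eU).
apply/eq_from_tnth => i; rewrite !(tnth_nth 0).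
have -> : nat_of_ord i = (n - (n - i))%N by have := ltn_ord i; lia.
by apply: TUn; lia.
Qed.

Lemma iter_promotion_rectangular T i : rectangular_tableau T ->
  rectangular_tableau (iter i (@promotion r n) T).
Proof. by move=> rT; elim: i => //= i; apply: promotion_rectangular. Qed.

Lemma iter_promotion_last T i : (iter i (@promotion r n) T)`_n = T`_n.
Proof. by elim: i => //= i; rewrite promotion_last. Qed.

(** Deleting row 0 leaves the same boundary values and the same local rule as in the diagram of
    [promotion T]. *)
Lemma pe_diagram_promotion T i j : (i <= j <= n + i)%N ->
  pe_diagram T i.+1 j.+1 = pe_diagram (promotion T) i j.
Proof.
elim: i j => [|i IHi] j; first by rewrite addn0 => /= jn; rewrite promotion_nth.
elim: j => [|j IHj] // /andP[ij jn].
have [ji|ij'] := leqP j.+1 i.+1.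
  have -> : j = i by lia.
  by rewrite !pe_diagram_diag promotion0.
have [nij|jn'] := leqP (n + i.+1) j.+1.
  have -> : j.+1 = (n + i.+1)%N by lia.
  by rewrite -addnS !pe_diagram_last promotion_last.
rewrite pe_diagram_local_rule //; last by lia.
rewrite [RHS]pe_diagram_local_rule //; last by lia.
rewrite -!pred_Sn !IHi ?IHj //; lia.
Qed.

Lemma pe_diagram_iter T i k : (k <= n)%N ->
  pe_diagram T i (i + k) = (iter i (@promotion r n) T)`_k.
Proof.
move=> kn; elim: i T => [|i IH] T; first by [].
by rewrite iterSr addSn pe_diagram_promotion ?IH //; lia.
Qed.

(** * Chains of subsets *)

(** Only the last subset and the accumulated sum are recorded. The maximum over chains is never
    formed: the arguments compare individual chains. *)
Inductive chain_value m p : nat -> (nat -> int) -> int -> Prop :=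
| ChainNil f of profile r m f : chain_value m p 0%N f 0
| ChainCons t f g v of chain_value m p t f v & profile r m g &
    (forall c, (c <= r)%N -> f c <= g c) :
    chain_value m p t.+1 g (v + dot (p t.+1 - p t) g).

Lemma chain_profile m p t f v : chain_value m p t f v -> profile r m f.
Proof. by case. Qed.

Lemma dot_profile_mono m x f g : generalized_partition x ->
  profile r m f -> profile r m g -> (forall c, (c <= r)%N -> f c <= g c) ->
  dot x f <= dot x g.
Proof.
by move=> part [f0 fr _] [g0 gr _]; apply: dot_mono; rewrite ?f0 ?fr ?g0 ?gr.
Qed.

(** Moving a subset up does not lower the sum over a partition, so replacing every subset by the
    last one bounds the value by a telescoping sum. *)
Lemma chain_value_dominant m p t f v :
  (forall s, (s <= t)%N -> generalized_partition (p s)) -> p 0%N = 0 ->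
  chain_value m p t f v -> v <= dot (p t) f.
Proof.
move=> part p0 ch; elim: ch part => {t f v} [f _|t f g v ch IH pg fg] part.
  by rewrite p0 dot0.
have := IH (fun s st => part s (leqW st)).
have := dot_profile_mono (part t (leqnSn t)) (chain_profile ch) pg fg.
by rewrite dotB; lia.
Qed.

(* The subsets of the new chain lie weakly above the old ones, and the last   *)
(* inequality bounds the loss in value by what this gains on the partition.   *)
(* To extend the new chain take the meet with the next subset, the pointwise  *)
(* maximum of the counting functions, on which [dot] is modular.              *)
Lemma chain_promotion m T i t f v : rectangular_tableau T -> (i + t < n)%N ->
  chain_value m (fun s => T`_(i + s).+1) t f v ->
  exists g w, [/\ chain_value m (fun s => (promotion T)`_(i + s)) t g w,
    forall c, (c <= r)%N -> f c <= g c &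
    v + dot T`_(i + t).+1 g <= w + dot T`_(i + t).+1 f].
Proof.
move=> rT itn ch; elim: ch itn => {t f v} [f pf|t f h v ch IH ph fh] itn.
  by exists f, 0; split=> //; constructor.
have itn' : (i + t < n)%N by lia.
have [g [w [chg fg vw]]] := IH itn'.
have pg := chain_profile chg; have pf := chain_profile ch.
have pM := profile_max pg ph.
set M := (fun c => _) in pM.
rewrite addnS in itn *.
have [partx _ _ /(_ m M pM)[K [pK MK yK lK zK]]] := promotion_local rT itn.
exists K, (w + dot ((promotion T)`_(i + t.+1) - (promotion T)`_(i + t)) K).
split.
- apply: (ChainCons chg pK) => c cr.
  by apply: le_trans (MK c cr); rewrite le_max lexx.
- by move=> c cr; apply: le_trans (MK c cr); rewrite le_max lexx orbT.
have modular : dot T`_(i + t).+1 f + dot T`_(i + t).+1 M <=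
               dot T`_(i + t).+1 g + dot T`_(i + t).+1 h.
  (* Both [g] and [h] lie above [f], hence so does [N]. *)
  pose N c := Num.min (g c) (h c).
  rewrite -(@dot_modular _ _ N M g h) => [|c _]; last by rewrite /N /M; lia.
  rewrite lerD2r; case: pf pg ph => [f0 fr _] [g0 gr _] [h0 hr _].
  apply: dot_mono; rewrite /N // ?f0 ?fr ?g0 ?gr ?h0 ?hr ?minxx // => c cr.
  by rewrite le_min fg ?fh.
move: zK modular vw; rewrite !addnS !dotB dotD yK lK; lia.
Qed.

(** Since the subsets only move up, the correction terms of [chain_promotion] cannot make the value
    drop. Indices fall by one per promotion, so the columns of the diagram stay the same and the
    segment ends up starting at index 0. *)
Lemma chain_iter_promotion m T i t f v :
  rectangular_tableau T -> (i + t <= n)%N ->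
  chain_value m (fun s => T`_(i + s)) t f v ->
  exists g w, [/\ chain_value m (fun s => (iter i (@promotion r n) T)`_s) t g w &
    v <= w].
Proof.
elim: i T f v => [|i IH] T f v rT itn ch; first by exists f, v.
have [g [w [chg fg vw]]] := chain_promotion rT itn ch.
have [g' [w' [chg' ww']]] := IH _ _ _ (promotion_rectangular rT) (ltnW itn) chg.
exists g', w'; rewrite iterSr; split=> //; apply: le_trans ww'.
have [[partT _] _] := rT.
have part : generalized_partition T`_(i + t).+1 := partT _ itn.
have := dot_profile_mono part (chain_profile ch) (chain_profile chg) fg; lia.
Qed.

(** * Extreme subsets and sizes *)

(** The profile of the first [k] rows, so that [dot x (top k)] is [D_k]. *)
Definition top k c : int := (minn c k)%:Z.

(** The profile of the last [k] rows; the truncated subtraction matters. *)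
Definition bottom k c : int := (c - (r - k))%N%:Z.

Lemma profile_top k : (k <= r)%N -> profile r k (top k).
Proof. by move=> kr; split; rewrite /top; try move=> c cr; lia. Qed.

Lemma profile_bottom k : (k <= r)%N -> profile r k (bottom k).
Proof. by move=> kr; split; rewrite /bottom; try move=> c cr; lia. Qed.

Lemma profile_le_top k f c : profile r k f -> (c <= r)%N -> f c <= top k c.
Proof.
move=> [f0 fr fi] cr.
have fc : f c <= c%:Z.
  elim: c cr => [|c IH] cr; first by rewrite f0.
  by have := IH (ltnW cr); have := fi c cr; lia.
have fk : f c <= k%:Z.
  have [d dr] : exists d, r = (c + d)%N by exists (r - c)%N; lia.
  have fcd e : (c + e <= r)%N -> f c <= f (c + e)%N.
    elim: e => [|e IH] ce; first by rewrite addn0.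
    by rewrite addnS in ce *; have := IH (ltnW ce); have := fi _ ce; lia.
  by have := fcd d; rewrite -dr fr; apply.
by rewrite /top; lia.
Qed.

Lemma dot_bottom x k : (k <= r)%N ->
  dot x (bottom k) = dot x (top r) - dot x (top (r - k)).
Proof.
move=> kr; apply/eqP; rewrite eq_sym subr_eq; apply/eqP.
have := @dot_modular r x (bottom k) (top (r - k)) (top r) (fun=> 0).
rewrite (_ : dot x (fun=> 0) = 0) ?addr0 => [->//|].
  by move=> c cr; rewrite /top /bottom; lia.
by apply: big1 => c _; rewrite subrr mulr0.
Qed.

Lemma dot_top_entry x (a : 'I_r) : dot x (top a.+1) - dot x (top a) = x 0 a.
Proof.
rewrite -sumrB (bigD1 a) //= big1 => [|c ca].
  rewrite addr0 /top -mulrBr (_ : _ - _ = 1) ?mulr1 //; lia.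
have : c != a :> nat by []; rewrite /top -mulrBr => ca'.
rewrite (_ : _ - _ = 0) ?mulr0 //; lia.
Qed.

Lemma row_eq_top x y : (forall k, (k <= r)%N -> dot x (top k) = dot y (top k)) ->
  x = y.
Proof.
move=> xy; apply/rowP => a; rewrite -!dot_top_entry !xy //.
exact: ltnW.
Qed.

Lemma rectangular_const T : rectangular T -> exists C, forall a, T`_n 0 a = C.
Proof.
move=> [_ Tn]; case: (pickP 'I_r) => [a _|none]; first by exists (T`_n 0 a) => b.
by exists 0 => a; have := none a.
Qed.

(** Each local rule permutes the entries of a step, so corresponding steps of consecutive rows have
    the same size. *)
Lemma promotion_size T i : rectangular_tableau T -> (i < n)%N ->
  dot (promotion T)`_i (top r) = dot T`_i.+1 (top r) - dot T`_1 (top r).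
Proof.
have sizeE x : dot x (top r) = \sum_c x 0 c.
  apply: eq_bigr => c _; have := ltn_ord c => cr.
  by rewrite (_ : _ - _ = 1) ?mulr1 // /top; lia.
move=> rT; elim: i => [|i IH] iN.
  by rewrite promotion0 subrr; case: rT => _ [-> _]; rewrite dot0.
have [_ [s st] _ _] := promotion_local rT iN.
have : dot ((promotion T)`_i.+1 - (promotion T)`_i) (top r) =
       dot (T`_i.+2 - T`_i.+1) (top r).
  rewrite st !sizeE (reindex_inj (@perm_inj _ s^-1)) /=.
  by apply: eq_bigr => c _; rewrite row_permE permKV.
by rewrite !dotB (IH (ltnW iN)); lia.
Qed.

Lemma iter_promotion_size T i t : rectangular_tableau T -> (i + t <= n)%N ->
  dot (iter i (@promotion r n) T)`_t (top r) =
  dot T`_(i + t) (top r) - dot T`_i (top r).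
Proof.
elim: i T t => [|i IH] T t rT itn.
  by case: rT => _ [-> _]; rewrite dot0 subr0.
rewrite addSn in itn *.
rewrite iterSr (IH _ _ (promotion_rectangular rT) (ltnW itn)).
have iN := leq_ltn_trans (leq_addr t i) itn.
by rewrite (promotion_size rT itn) (promotion_size rT iN); lia.
Qed.

(** * Comparison with the complement in the rectangle *)

(** The left side is [D_k] of the complement of [T_i], that is, the sum of the last [k] entries of
    [T_n - T_i]. It is the value of the chain that stays at the last [k] rows. *)
Lemma iter_promotion_complement_le T i k C : rectangular_tableau T ->
  (forall c, T`_n 0 c = C) -> (i <= n)%N -> (k <= r)%N ->
  C * k%:Z - dot T`_i (top r) + dot T`_i (top (r - k)) <=
  dot (iter i (@promotion r n) T)`_(n - i) (top k).
Proof.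
move=> rT TC iN kr; have pb := profile_bottom kr.
have constant t : chain_value k (fun s => T`_(i + s)) t (bottom k)
    (dot (T`_(i + t) - T`_i) (bottom k)).
  elim: t => [|t IH]; first by rewrite addn0 subrr dot0; constructor.
  have := ChainCons IH pb (fun _ _ => lexx _).
  by rewrite -dotD addrC subrKA.
have [|g [w [chg]]] := chain_iter_promotion rT _ (constant (n - i)%N); first by lia.
rewrite subnKC // dotB (dot_const _ TC) dot_bottom //.
have [-> -> _] := pb; rewrite subr0 => vw.
have [[partT _] [T0 _]] := iter_promotion_rectangular i rT.
have part s : (s <= n - i)%N ->
    generalized_partition (iter i (@promotion r n) T)`_s.
  by move=> sn; apply: partT; lia.
have := chain_value_dominant part T0 chg.
have pg := chain_profile chg.
have := dot_profile_mono (part _ (leqnn _)) pg (profile_top kr)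
  (fun c => profile_le_top pg).
lia.
Qed.

(** The middle term is [D_k] of the complement of the promoted entry, with its size computed by
    [iter_promotion_size]. It is kept because it is determined once the outer terms agree. *)
Lemma iter_promotion_n_ge T i k C : rectangular_tableau T ->
  (forall c, T`_n 0 c = C) -> (i <= n)%N -> (k <= r)%N ->
  dot T`_i (top k) <=
  dot (iter i (@promotion r n) T)`_(n - i) (top (r - k)) +
    dot T`_i (top r) - C * (r - k)%:Z /\
  dot (iter i (@promotion r n) T)`_(n - i) (top (r - k)) +
    dot T`_i (top r) - C * (r - k)%:Z <=
  dot (iter n (@promotion r n) T)`_i (top k).
Proof.
move=> rT TC iN kr; split.
  have := iter_promotion_complement_le rT TC iN (leq_subr k r).
  by rewrite subKn //; lia.
have rT' := iter_promotion_rectangular i rT.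
have TC' c : (iter i (@promotion r n) T)`_n 0 c = C by rewrite iter_promotion_last.
have := iter_promotion_complement_le rT' TC' (leq_subr i n) kr.
rewrite -iterD subnK // subKn // iter_promotion_size ?subnKC //.
rewrite (dot_const _ TC); have [-> -> _] := profile_top (leqnn r).
by rewrite -subzn // mulrBr; lia.
Qed.

Lemma fluctuating_bound T i (a : 'I_r) : rectangular_tableau T -> (i <= n)%N ->
  T`_i 0 a <= i%:Z.
Proof.
move=> [flT [T0 _]]; elim: i => [|i IH] iN; first by rewrite T0 mxE.
have := is_letter_le1 a (fluctuating_step flT iN); rewrite row_subE lerBlDr.
move/le_trans; apply; have -> : i.+1%:Z = 1 + i%:Z by lia.
by rewrite lerD2l; apply: IH; apply: ltnW.
Qed.

(** * The order of promotion *)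

Lemma promotion_order T : rectangular_tableau T ->
  iter n (@promotion r n) T = T.
Proof.
move=> rT; have [C TC] := rectangular_const (proj2 rT).
pose Q m := iter (m * n) (@promotion r n) T.
have rQ m : rectangular_tableau (Q m) by apply: iter_promotion_rectangular.
have QS m : Q m.+1 = iter n (@promotion r n) (Q m) by rewrite /Q mulSn iterD.
have QC m c : (Q m)`_n 0 c = C by rewrite iter_promotion_last.
have Qle m i k : (i <= n)%N -> (k <= r)%N ->
    dot (Q m)`_i (top k) <= dot (Q m.+1)`_i (top k).
  move=> iN kr; rewrite QS.
  by have [] := iter_promotion_n_ge (rQ m) (QC m) iN kr; apply: le_trans.
(* Every summand is weakly increasing in [m], and [Phi] is bounded, so it stalls somewhere and all
   summands stall with it. *)
pose Phi m := \sum_(i < n.+1) \sum_(k < r.+1) dot (Q m)`_i (top k).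
have [m PhiE] : exists m, Phi m.+1 <= Phi m.
  pose B : int := \sum_(i < n.+1) \sum_(k < r.+1) \sum_(c < r) n%:Z.
  have PhiB m : Phi m <= B.
    apply: ler_sum => i _; apply: ler_sum => k _; apply: ler_sum => c _.
    have iN : (i <= n)%N by rewrite -ltnS.
    have Qc := fluctuating_bound c (rQ m) iN; rewrite /top.
    have [ck|kc] := ltnP c k; last by rewrite (_ : _ - _ = 0) ?mulr0 //; lia.
    by rewrite (_ : _ - _ = 1) ?mulr1; [apply: le_trans Qc _|]; lia.
  have grow N : (exists m, Phi m.+1 <= Phi m) \/ Phi 0%N + N%:Z <= Phi N.
    elim: N => [|N [?|IH]]; [by right; rewrite addr0 | by left|].
    have [le|lt] := lerP (Phi N.+1) (Phi N); first by left; exists N.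
    by right; lia.
  have [//|] := grow (absz (B - Phi 0%N)).+1.
  by have := PhiB (absz (B - Phi 0%N)).+1; lia.
have {PhiE}QE : Q m.+1 = Q m.
  pose D a b := dot (Q m.+1)`_a (top b) - dot (Q m)`_a (top b).
  have D_ge0 (a : 'I_n.+1) (b : 'I_r.+1) : 0 <= D a b.
    by rewrite subr_ge0; apply: Qle; rewrite -ltnS.
  have row_ge0 (a : 'I_n.+1) : 0 <= \sum_(b < r.+1) D a b by apply: sumr_ge0.
  have sumD : \sum_(a < n.+1) \sum_(b < r.+1) D a b = 0.
    apply/eqP; rewrite eq_le sumr_ge0 // andbT.
    by under eq_bigr do rewrite sumrB; rewrite sumrB subr_le0.
  apply/eq_from_tnth => a; rewrite !(tnth_nth 0); apply: row_eq_top => k kr.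
  have rowD : \sum_(b < r.+1) D a b = 0.
    exact: psumr_eq0P (fun a _ => row_ge0 a) sumD _ isT.
  have /eqP : D a (Ordinal (kr : (k < r.+1)%N)) = 0.
    exact: psumr_eq0P (fun b _ => D_ge0 a b) rowD _ isT.
  by rewrite subr_eq0 => /eqP.
(* Injectivity strips the [m * n] promotions common to [Q m] and [Q m.+1]. *)
have iter_inj d U V : rectangular_tableau U -> rectangular_tableau V ->
    iter d (@promotion r n) U = iter d (@promotion r n) V -> U = V.
  move=> rU rV; elim: d => //= d IH UV; apply: IH.
  by apply: promotion_inj UV; apply: iter_promotion_rectangular.
apply: (iter_inj (m * n)%N) => //; first exact: iter_promotion_rectangular.
by rewrite -iterD addnC iterD -[RHS]QE QS.
Qed.

(** * Evacuation *)

(** By [promotion_order] the two bounds of [iter_promotion_n_ge] coincide, which fixes every [D_k],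
    hence every entry. *)
Lemma iter_promotion_complement T i (a : 'I_r) C : rectangular_tableau T ->
  (forall c, T`_n 0 c = C) -> (i <= n)%N ->
  (iter i (@promotion r n) T)`_(n - i) 0 a = C - T`_i 0 (rev_ord a).
Proof.
move=> rT TC iN; pose X := (iter i (@promotion r n) T)`_(n - i); rewrite -/X.
have XE k : (k <= r)%N ->
    dot X (top k) = dot T`_i (top (r - k)) - dot T`_i (top r) + C * k%:Z.
  move=> kr; have := iter_promotion_n_ge rT TC iN (leq_subr k r).
  by rewrite promotion_order // subKn // -/X; lia.
have ar := ltn_ord a.
rewrite -!dot_top_entry !XE //=; last exact: ltnW.
have -> : (r - a = (r - a.+1).+1)%N by lia.
have -> : a.+1%:Z = a%:Z + 1 by lia.
by rewrite mulrDr mulr1; lia.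
Qed.

Lemma evacuation_nth T k : (k <= n)%N ->
  (evacuation T)`_k = (iter (n - k) (@promotion r n) T)`_k.
Proof.
move=> kn; have kn1 : (k < n.+1)%N by [].
rewrite -(tnth_nth 0 _ (Ordinal kn1)) tnth_mktuple /=.
by rewrite -[X in pe_diagram _ _ X](subnK kn) pe_diagram_iter.
Qed.

Lemma eps_letter_alphabet (S : {set signed_index r}) :
  S \in alphabet r -> eps_letter S \in alphabet r.
Proof.
rewrite !inE => /forall_inP SS; apply/forall_inP => p /imsetP[p' p'S ->].
by apply/forall_inP => q /imsetP[q' q'S ->]; have /forall_inP/(_ q' q'S) := SS _ p'S.
Qed.

Lemma evec_eps_letter (S : {set signed_index r}) (a : 'I_r) :
  evec (eps_letter S) 0 a = evec S 0 (rev_ord a).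
Proof.
have mem_eps b : ((b, a) \in eps_letter S) = ((b, rev_ord a) \in S).
  apply/imsetP/idP => [[[b' a'] pS [-> ->]]|pS]; first by rewrite rev_ordK.
  by exists (b, rev_ord a); rewrite //= rev_ordK.
by rewrite !evecE !mem_eps.
Qed.

Lemma letter_evec (S : {set signed_index r}) :
  S \in alphabet r -> letter (evec S) = S.
Proof.
move=> SA; rewrite /letter; case: pickP => [S' /andP[S'A /eqP eS]|/(_ S)].
  exact: evec_inj eS.
by rewrite SA eqxx.
Qed.

(** Complementing and reading backwards each change the sign of a step; only the reversal of rows
    remains. *)
Lemma evacuation_step T k S : rectangular_tableau T -> (k < n)%N ->
  T`_(n - k) = T`_(n - k.+1) + evec S ->
  (evacuation T)`_k.+1 = (evacuation T)`_k + evec (eps_letter S).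
Proof.
move=> rT kn TS; have [C TC] := rectangular_const (proj2 rT).
apply/rowP => a; rewrite row_addE evec_eps_letter.
rewrite !evacuation_nth ?(ltnW kn) //.
have := @iter_promotion_complement T (n - k) a C rT TC (leq_subr _ _).
have := @iter_promotion_complement T (n - k.+1) a C rT TC (leq_subr _ _).
rewrite !subKn ?(ltnW kn) // TS => -> ->.
by rewrite row_addE opprD addrA addrNK.
Qed.

End Tableaux.

Theorem theorem6p5 (r n : nat) (T : (n.+1).-tuple 'rV[int]_r)
    (T_fluctuating : fluctuating_tableau T) (T_rectangular : rectangular T) :
  iter n (@promotion r n) T = T /\
  (fluctuating_tableau (evacuation T) /\
   lattice_word (evacuation T) = eps_word (lattice_word T)).
Proof.
have rT : rectangular_tableau T by [].
have [_ steps] := T_fluctuating.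
have step k : (k < n)%N -> exists S, [/\ S \in alphabet r,
    T`_(n - k) = T`_(n - k.+1) + evec S &
    (evacuation T)`_k.+1 = (evacuation T)`_k + evec (eps_letter S)].
  move=> kn; have [|S SA TS] := steps (n - k.+1)%N; first by lia.
  have e : ((n - k.+1).+1 = n - k)%N by lia.
  by exists S; rewrite e in TS; split=> //; apply: evacuation_step.
split; first exact: promotion_order.
split.
  split=> [k kn|k /step[S [SA _ eE]]].
    rewrite evacuation_nth //.
    by have [[part _] _] := iter_promotion_rectangular (n - k) rT; apply: part.
  by exists (eps_letter S); first exact: eps_letter_alphabet.
apply/eq_from_tnth => i; have [S [SA TS eE]] := step i (ltn_ord i).
rewrite tnth_mktuple eE addrAC subrr add0r letter_evec ?eps_letter_alphabet //.
rewrite (tnth_nth set0) /= nth_rev !size_map -?enumT size_enum_ord //.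
have ni : (n - i.+1 < n)%N by have := ltn_ord i; lia.
rewrite (nth_map set0) ?size_map -?enumT ?size_enum_ord //.
rewrite (nth_map (Ordinal ni)) ?size_enum_ord // nth_enum_ord //.
have -> : ((n - i.+1).+1 = n - i)%N by have := ltn_ord i; lia.
by rewrite TS addrAC subrr add0r letter_evec.
Qed.
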